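(* Let $S\in\{\tfrac12,1,\tfrac32,\dots\}$ and $\alpha\in\mathbb R$. Let $f,g:\mathbb N_0^2\to\mathbb C$ be functions such that $$f(2S-n,n)=\left(1-\frac{n-1}{2S}\right)^{\alpha-\frac12}\ (1\le n\le 2S),\qquad g(2S-n,n)=\left(1-\frac{n}{2S}\right)^{\frac12-\alpha}\ (0\le n\le 2S-1),$$ and let $\hat S^+_\alpha=\hat a_1^\dagger\hat a_2 f(\hat n_1,\hat n_2)$, $\hat S^-_\alpha=\hat a_2^\dagger\hat a_1 g(\hat n_1,\hat n_2)$, $\hat S^z=\tfrac12(\hat n_1-\hat n_2)$, restricted to $\mathcal H_{2S}=\mathrm{span}\{|n\rangle_S:0\le n\le2S\}$ with $|n\rangle_S:=|2S-n,n\rangle$. Then $f(2S-n-1,n+1)\,g(2S-n,n)=1$ for $0\le n\le 2S-1$, and $$\hat S^+_\alpha|n\rangle_S=\sqrt{2S}\,\sqrt n\left(1-\frac{n-1}{2S}\right)^{\alpha}|n-1\rangle_S\ (1\le n\le 2S),\qquad \hat S^+_\alpha|0\rangle_S=0,$$ $$\hat S^-_\alpha|n\rangle_S=\sqrt{2S}\,\sqrt{n+1}\left(1-\frac{n}{2S}\right)^{1-\alpha}|n+1\rangle_S\ (0\le n\le 2S-1),\qquad \hat S^-_\alpha|2S\rangle_S=0,$$ and $\hat S^z|n\rangle_S=(S-n)|n\rangle_S$. That is, under the linear identification $|n\rangle_S\leftrightarrow|n\rangle$ of $\mathcal H_{2S}$ with the single-mode physical subspace $\mathcal H_{\mathrm{phys}}=\mathrm{span}\{|n\rangle:0\le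 n\le 2S\}$, the two-mode operators coincide exactly on the physical subspace with the single-mode $\alpha$-family.
   Context: Two independent bosonic modes: the Fock space has basis $\{|n_1,n_2\rangle:(n_1,n_2)\in\mathbb N_0^2\}$, with $\hat a_1|n_1,n_2\rangle=\sqrt{n_1}|n_1-1,n_2\rangle$, $\hat a_1^\dagger|n_1,n_2\rangle=\sqrt{n_1+1}|n_1+1,n_2\rangle$, and similarly for $\hat a_2,\hat a_2^\dagger$ acting on $n_2$; $\hat n_i=\hat a_i^\dagger\hat a_i$. For $F:\mathbb N_0^2\to\mathbb C$, $F(\hat n_1,\hat n_2)|n_1,n_2\rangle=F(n_1,n_2)|n_1,n_2\rangle$. The single-mode $\alpha$-family on $\mathcal H_{\mathrm{phys}}$ is given by $\hat S^+_\alpha|n\rangle=\sqrt{2S}\sqrt n\,(1-\tfrac{n-1}{2S})^{\alpha}|n-1\rangle$ for $1\le n\le2S$, $\hat S^+_\alpha|0\rangle=0$, $\hat S^-_\alpha|n\rangle=\sqrt{2S}\sqrt{n+1}\,(1-\tfrac n{2S})^{1-\alpha}|n+1\rangle$ for $0\le n\le2S-1$, $\hat S^-_\alpha|2S\rangle=0$, $\hat S^z|n\rangle=(S-n)|n\rangle$; in operator form, $\hat S^+_\alpha=\sqrt{2S}\,\hat a(1-\tfrac{\hat n-1}{2S})^\alpha$, $\hat S^-_\alpha=\sqrt{2S}\,\hat a^\dagger(1-\tfrac{\hat n}{2S})^{1-\alpha}$, $\hat S^z=S-\hat n$, with $\hat a,\hat a^\dagger$ the standard single-mode operators. *)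

(* Defs.v *)
From HB Require Import structures.
From mathcomp Require Import all_boot all_order all_algebra.
From mathcomp Require Import complex.
From mathcomp Require Import freeg.
From mathcomp Require Import classical_sets functions reals exp.

Set Implicit Arguments.
Unset Strict Implicit.
Unset Printing Implicit Defensive.

Import Order.TTheory GRing.Theory Num.Theory.
Local Open Scope ring_scope.
Local Open Scope classical_set_scope.
Local Open Scope complex_scope.

(* The library equips [{freeg K / C}], the free C-module on the basis K, with
   the extension [fglift f] of a map f defined on the basis, but records only
   its additivity. *)
Section FgliftLinear.
Context (C : nzRingType) (K : choiceType) (M : lmodType C) (f : K -> M).

Lemma fglift_is_scalable : scalable (fglift f).
Proof.
move=> c D; rewrite -[D]freeg_sumE scaler_sumr.
have sumE s (F : K -> {freeg K / C}) :
    fglift f (\sum_(x <- s) F x) = \sum_(x <- s) fglift f (F x).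
  have f0 : fglift f 0 = 0 by rewrite -[0](subrr 0) lift_is_additive subrr.
  have fN u : fglift f (- u) = - fglift f u.
    by rewrite -sub0r lift_is_additive f0 sub0r.
  have fD u v : fglift f (u + v) = fglift f u + fglift f v.
    by rewrite -{1}[v]opprK lift_is_additive fN opprK.
  elim: s => [|x s IHs]; first by rewrite !big_nil.
  by rewrite !big_cons fD IHs.
rewrite !sumE scaler_sumr; apply: eq_bigr => x _.
have -> : c *: [freeg [:: (coeff x D, x)]] = [freeg [:: (c * coeff x D, x)]]
    :> {freeg K / C}.
  by apply/eqP/freeg_eqP => y; rewrite coeffZ !coeffU mulrA.
by rewrite !liftU scalerA.
Qed.

HB.instance Definition _ :=
  GRing.isZmodMorphism.Build {freeg K / C} M (fglift f)
    (@lift_is_additive C K M f).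
HB.instance Definition _ :=
  GRing.isScalable.Build C {freeg K / C} M *:%R (fglift f)
    fglift_is_scalable.
End FgliftLinear.

Section TwoMode.
Variable R : realType.

(* The algebraic span of the number states: the common invariant domain on
   which the ladder operators, unbounded on the Hilbert space completion, are
   determined by their values on the basis. *)
Definition Fock1 := {freeg nat / R[i]}.
Definition Fock2 := {freeg (nat * nat)%type / R[i]}.

Definition ket (n : nat) : Fock1 := [freeg [:: (1, n)]].
Definition ket2 (n1 n2 : nat) : Fock2 := [freeg [:: (1, (n1, n2))]].

Definition sqrtn (n : nat) : R[i] := (Num.sqrt (n%:R : R))%:C.

(* On the vacuum the truncated predecessor is harmless: the coefficient is
   sqrt 0 = 0. *)
Definition a1 : {linear Fock2 -> Fock2} :=
  fglift (fun n : nat * nat => sqrtn n.1 *: ket2 n.1.-1 n.2).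
Definition a2 : {linear Fock2 -> Fock2} :=
  fglift (fun n : nat * nat => sqrtn n.2 *: ket2 n.1 n.2.-1).
Definition a1dag : {linear Fock2 -> Fock2} :=
  fglift (fun n : nat * nat => sqrtn n.1.+1 *: ket2 n.1.+1 n.2).
Definition a2dag : {linear Fock2 -> Fock2} :=
  fglift (fun n : nat * nat => sqrtn n.2.+1 *: ket2 n.1 n.2.+1).

Definition num1 : {linear Fock2 -> Fock2} := a1dag \o a1.
Definition num2 : {linear Fock2 -> Fock2} := a2dag \o a2.

Definition fun_num (F : nat -> nat -> R[i]) : {linear Fock2 -> Fock2} :=
  fglift (fun n : nat * nat => F n.1 n.2 *: ket2 n.1 n.2).

Definition twoSplus (f : nat -> nat -> R[i]) : {linear Fock2 -> Fock2} :=
  a1dag \o a2 \o fun_num f.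
Definition twoSminus (g : nat -> nat -> R[i]) : {linear Fock2 -> Fock2} :=
  a2dag \o a1 \o fun_num g.
Definition twoSz : {linear Fock2 -> Fock2} := 2^-1 \*: (num1 \- num2).

(* The single-mode operators live on the physical subspace n <= 2S; their value
   0 on the other basis states is a mere totalization. *)
Definition oneSplus (S alpha : R) : {linear Fock1 -> Fock1} :=
  fglift (fun n : nat =>
    if (0 < n)%N && (n%:R <= 2 * S) then
      ((Num.sqrt (2 * S) * Num.sqrt n%:R
        * (1 - (n%:R - 1) / (2 * S)) `^ alpha)%:C : R[i]) *: ket n.-1
    else 0).
(* The second case contains n = 2S, where the operator form would involve
   0 `^ (1 - alpha). *)
Definition oneSminus (S alpha : R) : {linear Fock1 -> Fock1} :=
  fglift (fun n : nat =>
    if n%:R < 2 * S then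
      ((Num.sqrt (2 * S) * Num.sqrt n.+1%:R
        * (1 - n%:R / (2 * S)) `^ (1 - alpha))%:C : R[i]) *: ket n.+1
    else 0).
Definition oneSz (S : R) : {linear Fock1 -> Fock1} :=
  fglift (fun n : nat => ((S - n%:R)%:C : R[i]) *: ket n).

Definition span_of (V : lmodType R[i]) (d : nat) (e : 'I_d -> V) : set V :=
  [set v | exists c : 'I_d -> R[i], v = \sum_(i < d) c i *: e i].

(* Below, N stands for the natural number 2S. *)
Definition ketS (N n : nat) : Fock2 := ket2 (N - n) n.

Definition Hphys (N : nat) : set Fock1 :=
  span_of (fun n : 'I_N.+1 => ket n).
Definition H2S (N : nat) : set Fock2 :=
  span_of (fun n : 'I_N.+1 => ketS N n).

(* Meaningful on [Hphys N] only, where N - n is not truncated. *)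
Definition ident (N : nat) : {linear Fock1 -> Fock2} := fglift (ketS N).

(* A restricts to [H2S N], B restricts to [Hphys N], and [ident N] carries one
   restriction to the other. *)
Definition coincide (N : nat) (A : {linear Fock2 -> Fock2}) (B : {linear Fock1 -> Fock1}) :=
  [/\ set_fun (H2S N) (H2S N) A,
      set_fun (Hphys N) (Hphys N) B
    & forall psi, Hphys N psi -> A (ident N psi) = ident N (B psi)].

End TwoMode.

(* Main.v *)
Require Import Defs.
From mathcomp Require Import all_boot all_order all_algebra.
From mathcomp Require Import complex.
From mathcomp Require Import freeg.
From mathcomp Require Import classical_sets functions reals exp.
From mathcomp Require Import ring.

Set Implicit Arguments.
Unset Strict Implicit.
Unset Printing Implicit Defensive.

Import Order.TTheory GRing.Theory Num.Theory.
Local Open Scope ring_scope.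
Local Open Scope classical_set_scope.
Local Open Scope complex_scope.

(** On [ketS N n.+1] the ladder factor is
    [sqrt n.+1 * sqrt (N - n) = sqrt N * sqrt n.+1 * (1 - n / N) `^ (1 / 2)];
    the half power is exactly what the exponents of f and g compensate.
    The relation to the single-mode family is then checked on basis states, since
    everything is linear. *)

Section Span.
Variables (R : realType) (V : lmodType R[i]) (d : nat) (e : 'I_d -> V).

Lemma span_of0 : span_of e 0.
Proof. by exists (fun=> 0); rewrite big1 // => i _; rewrite scale0r. Qed.

Lemma span_ofD u v : span_of e u -> span_of e v -> span_of e (u + v).
Proof.
move=> [b ->] [c ->]; exists (fun i => b i + c i).
by rewrite -big_split; apply: eq_bigr => i _; rewrite scalerDl.
Qed.

Lemma span_ofZ a u : span_of e u -> span_of e (a *: u).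
Proof.
move=> [c ->]; exists (fun i => a * c i).
by rewrite scaler_sumr; apply: eq_bigr => i _; rewrite scalerA.
Qed.

Lemma span_of_basis i : span_of e (e i).
Proof.
exists (fun j => (j == i)%:R); rewrite (bigD1 i) //= eqxx scale1r big1 ?addr0 //.
by move=> j /negPf ->; rewrite scale0r.
Qed.

End Span.

Section LinearSpan.
Variables (R : realType) (V W : lmodType R[i]) (d : nat) (e : 'I_d -> V).

Lemma linear_span_of (d' : nat) (e' : 'I_d' -> W) (A : {linear V -> W}) :
  (forall i, span_of e' (A (e i))) -> set_fun (span_of e) (span_of e') A.
Proof.
move=> Ae _ [c ->]; rewrite linear_sum.
apply: (big_ind (span_of e')) => [|u v|i _].
- exact: span_of0.
- exact: span_ofD.
- by rewrite linearZ; apply: span_ofZ.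
Qed.

Lemma linear_span_of_eq (A B : {linear V -> W}) :
  (forall i, A (e i) = B (e i)) -> {in span_of e, A =1 B}.
Proof.
move=> AB u /set_mem[c ->]; rewrite !linear_sum; apply: eq_bigr => i _.
by rewrite !linearZ AB.
Qed.

End LinearSpan.

Section TwoMode.
Variable R : realType.

Lemma fglift_ket (M : lmodType R[i]) (h : nat -> M) n :
  fglift h (ket R n) = h n.
Proof. by rewrite liftU scale1r. Qed.

Lemma fglift_ket2 (M : lmodType R[i]) (h : nat * nat -> M) m n :
  fglift h (ket2 R m n) = h (m, n).
Proof. by rewrite liftU scale1r. Qed.

Lemma sqrtn0 : sqrtn R 0 = 0.
Proof. by rewrite /sqrtn sqrtr0. Qed.

Lemma sqrtnK n : sqrtn R n * sqrtn R n = n%:R.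
Proof. by rewrite /sqrtn -rmorphM -expr2 sqr_sqrtr ?ler0n // rmorph_nat. Qed.

Lemma num1_ket2 m n : num1 R (ket2 R m n) = m%:R *: ket2 R m n.
Proof.
rewrite /num1 /= fglift_ket2 linearZ /= fglift_ket2 scalerA.
(* At [m = 0] the truncated predecessor would give the wrong coefficient, but [sqrtn R 0]
   annihilates the term; otherwise the two equal roots multiply to the occupation number. *)
by case: m => [|m] /=; rewrite ?sqrtn0 ?mul0r ?scale0r // sqrtnK.
Qed.

Lemma num2_ket2 m n : num2 R (ket2 R m n) = n%:R *: ket2 R m n.
Proof.
rewrite /num2 /= fglift_ket2 linearZ /= fglift_ket2 scalerA.
by case: n => [|n] /=; rewrite ?sqrtn0 ?mul0r ?scale0r // sqrtnK.
Qed.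

(** [fun_num f] acts first, so [f] is read at the initial occupation numbers. The truncation in
    [n.-1] does no harm at [n = 0], where [sqrtn R n] vanishes. *)
Lemma twoSplus_ket2 f m n : twoSplus f (ket2 R m n)
  = (f m n * (sqrtn R n * sqrtn R m.+1)) *: ket2 R m.+1 n.-1.
Proof.
by rewrite /twoSplus /= fglift_ket2 !linearZ /= fglift_ket2 linearZ /=
  fglift_ket2 !scalerA mulrA.
Qed.

Lemma twoSminus_ket2 g m n : twoSminus g (ket2 R m n)
  = (g m n * (sqrtn R m * sqrtn R n.+1)) *: ket2 R m.-1 n.+1.
Proof.
by rewrite /twoSminus /= fglift_ket2 !linearZ /= fglift_ket2 linearZ /=
  fglift_ket2 !scalerA mulrA.
Qed.

Lemma twoSz_ket2 m n :
  twoSz R (ket2 R m n) = (2^-1 * (m%:R - n%:R)) *: ket2 R m n.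
Proof.
rewrite /twoSz -[LHS]/(2^-1 *: (num1 R (ket2 R m n) - num2 R (ket2 R m n))).
by rewrite num1_ket2 num2_ket2 -scalerBl scalerA.
Qed.

Lemma ident_ket N n : ident R N (ket R n) = ketS R N n.
Proof. exact: fglift_ket. Qed.

(** Expanding over the finite support lets an identity of linear maps on all of [Fock1] be tested on
    kets. *)
Lemma ket_expansion (u : Fock1 R) : u = \sum_(n <- dom u) coeff n u *: ket R n.
Proof.
rewrite -[LHS]freeg_sumE; apply: eq_bigr => n _.
by apply/eqP/freeg_eqP => m; rewrite coeffZ !coeffU mul1r.
Qed.

(** The second occupation number of [ketS R N n] is [n] itself, so forgetting the first one gives a
    linear left inverse [J], even for [n > N], where [N - n] truncates. *)
Lemma ident_inj N : injective (ident R N).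
Proof.
pose J : {linear Fock2 R -> Fock1 R} := fglift (fun m : nat * nat => ket R m.2).
apply: (can_inj (g := J)) => u.
rewrite [u]ket_expansion !linear_sum; apply: eq_bigr => n _.
by rewrite !linearZ /= ident_ket /J /= fglift_ket2.
Qed.

Lemma ident_bij N : set_bij (@Hphys R N) (@H2S R N) (ident R N).
Proof.
split.
- apply: linear_span_of => i; rewrite ident_ket; exact: span_of_basis.
- by move=> u v _ _; apply: ident_inj.
- move=> _ [c ->]; exists (\sum_(i < N.+1) c i *: ket R i); first by exists c.
  by rewrite linear_sum; apply: eq_bigr => i _; rewrite linearZ /= ident_ket.
Qed.

(** Invariance of [H2S N] under [A] comes from intertwining: a vector there is [ident R N u] with
    [u] in [Hphys N], and [A] sends it to [ident R N (B u)], with [B u] still in [Hphys N]. *)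
Lemma coincide_basis N (A : {linear Fock2 R -> Fock2 R})
    (B : {linear Fock1 R -> Fock1 R}) :
  (forall n, (n <= N)%N -> Hphys N (B (ket R n))) ->
  (forall n, (n <= N)%N -> A (ketS R N n) = ident R N (B (ket R n))) ->
  coincide N A B.
Proof.
move=> HB AB.
have B_phys : set_fun (Hphys N) (Hphys N) B.
  by apply: linear_span_of => i; apply: HB; rewrite -ltnS.
have ABident u : Hphys N u -> A (ident R N u) = ident R N (B u).
  move=> Hu; apply: (linear_span_of_eq (A := A \o ident R N)
    (B := ident R N \o B) _ (mem_set Hu)) => i /=.
  by rewrite ident_ket AB // -ltnS.
have [ident_fun _ ident_surj] := ident_bij N.
split=> // v /ident_surj[u Hu <-].
by rewrite ABident //; apply/ident_fun/B_phys.
Qed.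

Lemma Hphys_ket N n : (n <= N)%N -> Hphys N (ket R n).
Proof.
rewrite -ltnS => ltnN.
exact: (span_of_basis (fun i : 'I_N.+1 => ket R i) (Ordinal ltnN)).
Qed.

(** Take the factor [N] out of [N - n] under the root. At [n = N] both sides are 0, as 0 to the
    power 1/2 is 0. *)
Lemma sqrt_natB (N n : nat) : (0 < N)%N -> (n <= N)%N ->
  Num.sqrt ((N - n)%N%:R : R) = Num.sqrt N%:R * (1 - n%:R / N%:R) `^ (1 / 2).
Proof.
move=> N0 nN; have NR : (0 : R) < N%:R by rewrite ltr0n.
have -> : 1 / 2 = 2^-1 :> R by rewrite mul1r.
have -> : 1 - n%:R / N%:R = (N - n)%N%:R / N%:R :> R.
  by rewrite natrB // mulrBl divff ?gt_eqF.
rewrite powR12_sqrt ?divr_ge0 ?ler0n // -sqrtrM ?ler0n //.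
by rewrite mulrCA divff ?mulr1 ?gt_eqF.
Qed.

(** A nonzero base meets the side condition for adding exponents in [powR], even when they sum to
    0. *)
Lemma level_gt0 (N n : nat) : (n < N)%N -> 0 < 1 - n%:R / N%:R :> R.
Proof.
move=> nN; rewrite subr_gt0 ltr_pdivrMr ?mul1r ?ltr_nat //.
by rewrite ltr0n (leq_ltn_trans _ nN).
Qed.

End TwoMode.

Theorem mainTheorem4 (R : realType) (S alpha : R) (N : nat)
    (hN : (0 < N)%N) (hS : 2 * S = N%:R)
    (f g : nat -> nat -> R[i])
    (hf : forall n : nat, (1 <= n <= N)%N ->
      f (N - n)%N n
        = ((1 - (n%:R - 1) / (2 * S)) `^ (alpha - 1 / 2))%:C)
    (hg : forall n : nat, (0 <= n <= N - 1)%N ->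
      g (N - n)%N n = ((1 - n%:R / (2 * S)) `^ (1 / 2 - alpha))%:C) :
  (forall n : nat, (0 <= n <= N - 1)%N ->
      f (N - n - 1)%N n.+1 * g (N - n)%N n = 1)
  /\ [/\ (forall n : nat, (1 <= n <= N)%N ->
            twoSplus f (ketS R N n)
            = (Num.sqrt (2 * S) * Num.sqrt n%:R
                 * (1 - (n%:R - 1) / (2 * S)) `^ alpha)%:C
              *: ketS R N (n - 1)),
         twoSplus f (ketS R N 0) = 0,
         (forall n : nat, (0 <= n <= N - 1)%N ->
            twoSminus g (ketS R N n)
            = (Num.sqrt (2 * S) * Num.sqrt (n.+1)%:R
                 * (1 - n%:R / (2 * S)) `^ (1 - alpha))%:C
              *: ketS R N n.+1),
         twoSminus g (ketS R N N) = 0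
       & (forall n : nat, (0 <= n <= N)%N ->
            twoSz R (ketS R N n) = (S - n%:R)%:C *: ketS R N n)]
  /\ [/\ set_bij (@Hphys R N) (@H2S R N) (ident R N),
         coincide N (twoSplus f) (oneSplus S alpha),
         coincide N (twoSminus g) (oneSminus S alpha)
       & coincide N (twoSz R) (oneSz S)].
Proof.
rewrite hS in hf hg *.
have natSB n : n.+1%:R - 1 = n%:R :> R by rewrite mulrSr addrK.
(* Shifting the index by one gives [f] the same base [1 - n / N] that [g] has at level [n]. *)
have fE n : (n < N)%N ->
    f (N - n.+1)%N n.+1 = ((1 - n%:R / N%:R) `^ (alpha - 1 / 2))%:C.
  by move=> nN; rewrite hf // natSB.
have gE n : (n < N)%N -> g (N - n)%N n = ((1 - n%:R / N%:R) `^ (1 / 2 - alpha))%:C.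
  by move=> nN; rewrite hg // leq0n leq_subRL.
have ltN n : (n <= N - 1)%N = (n < N)%N by rewrite leq_subRL.
have plusE n : (n < N)%N -> twoSplus f (ketS R N n.+1)
    = (Num.sqrt N%:R * Num.sqrt n.+1%:R * (1 - n%:R / N%:R) `^ alpha)%:C
      *: ketS R N n.
  (* Since [n < N], no truncation occurs in [N - n.+1], and its successor is [N - n]. *)
  move=> nN; rewrite /ketS twoSplus_ket2 fE // -subSn // subSS.
  congr (_ *: _); rewrite /sqrtn -!rmorphM; congr (_%:C).
  (* Of the exponent [alpha], the part [alpha - 1 / 2] comes from [f] and the part [1 / 2] from the
     root of [N - n]. *)
  rewrite sqrt_natB ?(ltnW nN) // -[alpha in RHS](subrK (1 / 2)).
  rewrite [in RHS]powRD; last by rewrite (gt_eqF (level_gt0 R nN)) implybT.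
  by ring.
have plus0 : twoSplus f (ketS R N 0) = 0.
  by rewrite twoSplus_ket2 sqrtn0 mul0r mulr0 scale0r.
have minusE n : (n < N)%N -> twoSminus g (ketS R N n)
    = (Num.sqrt N%:R * Num.sqrt n.+1%:R * (1 - n%:R / N%:R) `^ (1 - alpha))%:C
      *: ketS R N n.+1.
  move=> nN; rewrite /ketS twoSminus_ket2 gE // -subnS.
  congr (_ *: _); rewrite /sqrtn -!rmorphM; congr (_%:C).
  have -> : 1 - alpha = 1 / 2 - alpha + 1 / 2 by field.
  rewrite sqrt_natB ?(ltnW nN) //.
  rewrite [in RHS]powRD; last by rewrite (gt_eqF (level_gt0 R nN)) implybT.
  by ring.
(* The first mode is empty here, so its lowering coefficient vanishes whatever the value of [g] at
   [(0, N)]. *)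
have minusN : twoSminus g (ketS R N N) = 0.
  by rewrite /ketS subnn twoSminus_ket2 sqrtn0 mul0r mulr0 scale0r.
have SzE n : (n <= N)%N -> twoSz R (ketS R N n) = (S - n%:R)%:C *: ketS R N n.
  move=> nN; rewrite /ketS twoSz_ket2; congr (_ *: _).
  have -> : S = 2^-1 * N%:R by rewrite -hS mulKf ?pnatr_eq0.
  by rewrite natrB // rmorphB rmorphM fmorphV !rmorph_nat; field.
split; last split; last split.
(* Both factors are powers of [1 - n / N] with opposite exponents. *)
- move=> n; rewrite ltN /= => nN; rewrite -subnDA addn1 fE // gE // -rmorphM.
  rewrite -powRD ?(gt_eqF (level_gt0 R nN)) ?implybT //.
  by rewrite addrC subrKA subrr powRr0.
- split=> //.
  + by case=> // n; rewrite subn1 natSB; apply: plusE.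
  + by move=> n; rewrite ltN; apply: minusE.
- exact: ident_bij.
- have one0 : oneSplus S alpha (ket R 0) = 0 by exact: fglift_ket.
  have oneE n : (n < N)%N -> oneSplus S alpha (ket R n.+1)
      = (Num.sqrt N%:R * Num.sqrt n.+1%:R * (1 - n%:R / N%:R) `^ alpha)%:C
        *: ket R n.
    by move=> nN; rewrite [LHS]fglift_ket hS ler_nat nN natSB.
  apply: coincide_basis => [] [|n] nN.
  + by rewrite one0; apply: span_of0.
  + by rewrite oneE //; apply/span_ofZ/Hphys_ket/ltnW.
  + by rewrite one0 linear0.
  + by rewrite oneE // linearZ ident_ket plusE.
(* The guard in [oneSminus] separates [n < N] from the top level [n = N], where both sides are 0. *)
- apply: coincide_basis => n nN; rewrite [oneSminus _ _ _]fglift_ket hS ltr_nat;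
    case: ltnP => // ltnN.
  + exact/span_ofZ/Hphys_ket.
  + exact: span_of0.
  + by rewrite linearZ ident_ket minusE.
  + by rewrite linear0 (@anti_leq n N) ?nN.
- apply: coincide_basis => n nN; rewrite [oneSz _ _]fglift_ket.
  + exact/span_ofZ/Hphys_ket.
  + by rewrite linearZ ident_ket SzE.
Qed.
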